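(* For any $q$ (an indeterminate, or a complex number with $|q|>1$), the following identity of formal power series in $u$ holds: $$\frac{\prod_{i\ge1}(1+u/q^i)}{\prod_{i\ge1}(1-u^2/q^i)}=\sum_{n\ge0}u^n q^{\binom n2}\sum_{r=0}^{\lfloor n/2\rfloor}\frac{1}{q^{r(2n-3r)}\gamma_r\gamma_{n-2r}}.$$
   Context: For $j\ge1$, $\gamma_j=q^{\binom{j}{2}}(q^j-1)(q^{j-1}-1)\cdots(q-1)=q^{j^2}(1-1/q)\cdots(1-1/q^j)$, and $\gamma_0=1$. When $q$ is an indeterminate, coefficients of powers of $u$ are taken in the field $\mathbb{Q}((q^{-1}))$ of formal Laurent series in $q^{-1}$; when $q$ is a complex number with $|q|>1$, the coefficients are convergent complex series. *)

(* Defs.v *)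
From HB Require Import structures.
From mathcomp Require Import all_boot all_order all_algebra.
From mathcomp Require Import boolp classical_sets reals topology normedtype.
From mathcomp Require Import complex.

Set Implicit Arguments.
Unset Strict Implicit.
Unset Printing Implicit Defensive.

Import Order.TTheory GRing.Theory Num.Theory.
Import numFieldNormedType.Exports.
Local Open Scope ring_scope.

Record fps (R : Type) := Fps { fps_coef :> nat -> R }.

HB.instance Definition _ (R : Type) := gen_eqMixin (fps R).
HB.instance Definition _ (R : Type) := gen_choiceMixin (fps R).

Lemma fpsP (R : Type) (f g : fps R) : f =1 g <-> f = g.
Proof.
split=> [|->//]; case: f g => [f] [g] /= eq_fg.
by congr Fps; apply: funext.
Qed.

Section Ring.
Variable R : comNzRingType.
Implicit Types f g h : fps R.

Definition fpsC (c : R) : fps R := Fps (fun n => if n == 0%N then c else 0).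
Definition fpsX : fps R := Fps (fun n => (n == 1%N)%:R).

Definition fps_opp f : fps R := Fps (fun n => - f n).
Definition fps_add f g : fps R := Fps (fun n => f n + g n).
Definition fps_mul f g : fps R :=
  Fps (fun n => \sum_(i < n.+1) f i * g (n - i)%N).

Lemma fps_addA : associative fps_add.
Proof. by move=> f g h; apply/fpsP => n /=; rewrite addrA. Qed.
Lemma fps_addC : commutative fps_add.
Proof. by move=> f g; apply/fpsP => n /=; rewrite addrC. Qed.
Lemma fps_add0 : left_id (fpsC 0) fps_add.
Proof. by move=> f; apply/fpsP => n /=; rewrite if_same add0r. Qed.
Lemma fps_addN : left_inverse (fpsC 0) fps_opp fps_add.
Proof. by move=> f; apply/fpsP => n /=; rewrite if_same addNr. Qed.

HB.instance Definition _ :=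
  GRing.isZmodule.Build (fps R) fps_addA fps_addC fps_add0 fps_addN.

(* Ring identities are transported from {poly R} through truncation. *)
Definition fps_trunc (m : nat) f : {poly R} := \poly_(i < m) f i.

Lemma fps_mul_trunc m f g n : (n < m)%N ->
  fps_mul f g n = (fps_trunc m f * fps_trunc m g)`_n.
Proof.
move=> ltnm; rewrite coefM /=; apply: eq_bigr => i _.
have lein : (i <= n)%N by rewrite -ltnS.
by rewrite !coef_poly (leq_ltn_trans lein ltnm)
  (leq_ltn_trans (leq_subr _ _) ltnm).
Qed.

Lemma fps_mulC : commutative fps_mul.
Proof.
by move=> f g; apply/fpsP => n; rewrite !(fps_mul_trunc _ _ (ltnSn n)) mulrC.
Qed.

Lemma fps_mulA : associative fps_mul.
Proof.
move=> f g h; apply/fpsP => n.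
pose T := fps_trunc n.+1.
transitivity (T f * T g * T h)`_n; last first.
  rewrite coefM /=; apply: eq_bigr => i _; have lti := ltn_ord i.
  by rewrite -(fps_mul_trunc _ _ lti) coef_poly ltnS leq_subr.
rewrite -mulrA coefM /=; apply: eq_bigr => i _; have lti := ltn_ord i.
by rewrite coef_poly lti -fps_mul_trunc // ltnS leq_subr.
Qed.

Lemma fps_mul1 : left_id (fpsC 1) fps_mul.
Proof.
move=> f; apply/fpsP => n /=.
rewrite big_ord_recl big1 /= => [|i _]; last by rewrite mul0r.
by rewrite mul1r addr0 subn0.
Qed.

Lemma fps_mulDl : left_distributive fps_mul fps_add.
Proof.
move=> f g h; apply/fpsP => n /=; rewrite -big_split /=.
by apply: eq_bigr => i _; rewrite mulrDl.
Qed.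

Lemma fps_1_neq0 : fpsC 1 != 0.
Proof.
by apply/eqP => /fpsP /(_ 0%N) /= /eqP; rewrite oner_eq0.
Qed.

HB.instance Definition _ := GRing.Zmodule_isComNzRing.Build (fps R)
  fps_mulA fps_mulC fps_mul1 fps_mulDl fps_1_neq0.

Lemma fps_coef0 n : (0 : fps R) n = 0.
Proof. exact: if_same. Qed.
Lemma fps_coef1 n : (1 : fps R) n = (n == 0%N)%:R.
Proof. by rewrite /=; case: eqP. Qed.
Lemma fps_coefD f g n : (f + g) n = f n + g n.
Proof. by []. Qed.
Lemma fps_coefN f n : (- f) n = - f n.
Proof. by []. Qed.
Lemma fps_coefM f g n : (f * g) n = \sum_(i < n.+1) f i * g (n - i)%N.
Proof. by []. Qed.

Lemma fps_coefCM c f n : (fpsC c * f) n = c * f n.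
Proof.
rewrite fps_coefM big_ord_recl big1 /= => [|i _]; last by rewrite mul0r.
by rewrite addr0 subn0.
Qed.

Lemma fps_coefXM f n : (fpsX * f) n = if n is n'.+1 then f n' else 0.
Proof.
case: n => [|n]; first by rewrite fps_coefM big_ord_recl big_ord0 mul0r addr0.
rewrite fps_coefM 2!big_ord_recl big1 /= => [|i _]; last by rewrite mul0r.
by rewrite mul0r add0r mul1r addr0 subSS subn0.
Qed.

Lemma fps_coefXnM f k n :
  (fpsX ^+ k * f) n = if (n < k)%N then 0 else f (n - k)%N.
Proof.
elim: k n => [|k IHk] n; first by rewrite expr0 mul1r subn0.
by rewrite exprS -mulrA fps_coefXM; case: n => [|n]; rewrite ?IHk.
Qed.

End Ring.

Section UnitRing.
Variable R : comUnitRingType.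
Implicit Types f g : fps R.

Fixpoint fps_inv_seq f (n : nat) : seq R :=
  if n is n'.+1 then
    rcons (fps_inv_seq f n')
      ((f 0%N)^-1 * ((n' == 0%N)%:R
                     - \sum_(i < n') (fps_inv_seq f n')`_i * f (n' - i)%N))
  else [::].

Definition fps_unit : pred (fps R) := fun f => f 0%N \is a GRing.unit.
Definition fps_inv f : fps R :=
  if fps_unit f then Fps (fun n => (fps_inv_seq f n.+1)`_n) else f.

Lemma size_fps_inv_seq f n : size (fps_inv_seq f n) = n.
Proof. by elim: n => //= n IHn; rewrite size_rcons IHn. Qed.

Lemma nth_fps_inv_seq f n i : (i < n)%N ->
  (fps_inv_seq f n)`_i = (fps_inv_seq f i.+1)`_i.
Proof.
elim: n => // n IHn; rewrite ltnS leq_eqVlt => /predU1P[-> //|ltin].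
by rewrite [LHS]/= nth_rcons size_fps_inv_seq ltin IHn.
Qed.

Lemma fps_mulVr : {in fps_unit, left_inverse 1 fps_inv *%R}.
Proof.
move=> f Uf; rewrite /fps_inv (Uf : fps_unit f).
apply/fpsP => n; rewrite fps_coefM fps_coef1 big_ord_recr /=.
rewrite nth_rcons size_fps_inv_seq ltnn eqxx subnn [X in _ + X]mulrC mulVKr //.
rewrite addrC.
under [X in _ - X]eq_bigr => i _ do rewrite nth_fps_inv_seq ?ltn_ord //.
by rewrite subrK.
Qed.

Lemma fps_unitPl f g : g * f = 1 -> fps_unit f.
Proof.
move/fpsP/(_ 0%N); rewrite fps_coefM big_ord_recl big_ord0 addr0 fps_coef1 /=.
by move=> gf1; apply/unitrPr; exists (g 0%N); rewrite mulrC.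
Qed.

Lemma fps_inv_out : {in [predC fps_unit], fps_inv =1 id}.
Proof. by move=> f; rewrite /fps_inv => /(negPf : ~~ fps_unit f -> _) ->. Qed.

HB.instance Definition _ := GRing.ComNzRing_hasMulInverse.Build (fps R)
  fps_mulVr fps_unitPl fps_inv_out.

Lemma fps_unitE f : (f \is a GRing.unit) = (f 0%N \is a GRing.unit).
Proof. by []. Qed.

End UnitRing.

Section IntegralDomain.
Variable R : idomainType.
Implicit Types f g : fps R.

Lemma fps_factor f : f != 0 -> exists k g, f = fpsX R ^+ k * g /\ g 0%N != 0.
Proof.
move=> nz_f; have ex_n : exists n, f n != 0.
  apply: contrapT => no_n; move/eqP: nz_f; apply; apply/fpsP => n.
  by rewrite fps_coef0; apply/eqP/negPn/negP => nz; apply: no_n; exists n.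
case: (ex_minnP ex_n) => k nz_k min_k.
exists k, (Fps (fun n => f (n + k)%N)); split=> //.
apply/fpsP => n; rewrite fps_coefXnM; case: ltnP => [ltnk|lekn] /=.
  by apply/eqP/negPn/negP => /min_k; rewrite leqNgt ltnk.
by rewrite subnK.
Qed.

Lemma fps_integral f g : f * g = 0 -> (f == 0) || (g == 0).
Proof.
have [//|/fps_factor[j [f' [-> nz_f]]]] := eqVneq f 0.
have [//|/fps_factor[k [g' [-> nz_g]]]] := eqVneq g 0.
rewrite mulrACA -exprD => /fpsP /(_ (j + k)%N).
rewrite fps_coefXnM ltnn subnn fps_coef0 fps_coefM big_ord1 /= subnn.
by move/eqP; rewrite mulf_eq0 (negPf nz_f) (negPf nz_g).
Qed.

HB.instance Definition _ :=
  GRing.ComUnitRing_isIntegral.Build (fps R) fps_integral.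

End IntegralDomain.

(* F((t)) is the fraction field of F[[t]]; see laurent_repr. *)
Notation laurent F := {fraction (fps F)}.
Notation laurent_of_fps := (@FracField.tofrac (fps _)).

Lemma fraction_repr (D : idomainType) (x : {fraction D}) :
  exists a b : D, b != 0 /\ x = FracField.tofrac a / FracField.tofrac b.
Proof.
elim/quotW: x => r; exists \n_r, \d_r; split; first exact: denom_ratioP.
have nz_d : FracField.tofrac \d_r != 0 by rewrite tofrac_eq0 denom_ratioP.
apply: (canRL (mulfK nz_d)).
unlock FracField.tofrac; rewrite -[LHS]FracField.pi_mul.
apply/eqmodP; rewrite /= FracField.equivfE /FracField.mulf.
by rewrite !numden_Ratio ?mulf_neq0 ?oner_neq0 ?denom_ratioP // !mulr1 mulrC.
Qed.

Section Laurent.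
Variable F : fieldType.

(* The series variable of [laurent] plays the role of q^-1. *)
Definition laurent_q : laurent F := (laurent_of_fps (fpsX F))^-1.

(* Convergence for the (q^-1)-adic topology:
   u m - l lies in q^-k F[[q^-1]] for all large m, for every k. *)
Definition laurent_cvg (u : nat -> laurent F) (l : laurent F) : Prop :=
  forall k : nat, exists N : nat, forall m : nat, (N <= m)%N ->
    exists w : fps F, u m - l = laurent_q ^- k * laurent_of_fps w.

Lemma laurent_of_fpsXn k :
  laurent_of_fps (fpsX F ^+ k) = laurent_q ^- k.
Proof.
by rewrite /laurent_q exprVn invrK [LHS](rmorphXn (@FracField.tofrac (fps F))).
Qed.

(* Every element is a power series in q^-1 times a power of q. *)
Lemma laurent_repr (x : laurent F) :
  exists k (f : fps F), x = laurent_q ^+ k * laurent_of_fps f.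
Proof.
have [a [b [nz_b ->]]] := fraction_repr x.
have [k [g [-> nz_g]]] := fps_factor nz_b.
have Ug : g \is a GRing.unit by rewrite fps_unitE unitfE.
exists k, (a / g).
have nz_tg : laurent_of_fps g != 0.
  by rewrite tofrac_eq0; apply: contraNneq nz_g => ->.
have -> : laurent_of_fps (fpsX F ^+ k * g)
        = laurent_q ^- k * laurent_of_fps g.
  by rewrite -laurent_of_fpsXn; exact: tofracM.
rewrite invfM invrK mulrCA; congr (_ * _).
apply: (canLR (mulfK nz_tg)).
by rewrite -[RHS]tofracM divrK.
Qed.

Lemma laurent_cvg_unique u l1 l2 :
  laurent_cvg u l1 -> laurent_cvg u l2 -> l1 = l2.
Proof.
move=> cv1 cv2.
have dl k : exists w : fps F, l1 - l2 = laurent_of_fps (fpsX F ^+ k * w).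
  have [N1 /(_ _ (leq_maxl _ _)) cv1k] := cv1 k.
  have [N2 /(_ _ (leq_maxr _ _)) cv2k] := cv2 k.
  have [w1 e1] := cv1k N2; have [w2 e2] := cv2k N1.
  exists (w2 - w1).
  rewrite [RHS]tofracM tofracB [X in X * _]laurent_of_fpsXn mulrBr -e1 -e2.
  by rewrite opprB [RHS]addrC addrA subrK.
have [w0] := dl 0%N; rewrite expr0 mul1r => e0.
apply/eqP; rewrite -subr_eq0 e0 tofrac_eq0; apply/eqP/fpsP => n.
have [w] := dl n.+1; rewrite e0 => /eqP; rewrite tofrac_eq => /eqP->.
by rewrite fps_coefXnM ltnSn fps_coef0.
Qed.

End Laurent.

(* Topology given by the norm of K, used for K the complex numbers. *)
Definition norm_cvg (K : numFieldType) (u : nat -> K) (l : K) : Prop :=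
  (u @ \oo --> l)%classic.

(* The infinite product starts at i = 1; each coefficient of its partial
   products converges in K in the sense of cvg. *)
Definition fps_infinite_prod (K : fieldType) (cvg : (nat -> K) -> K -> Prop)
    (f : nat -> fps K) (P : fps K) : Prop :=
  forall n : nat,
    cvg (fun m : nat => (\prod_(1 <= i < m.+1) f i : fps K) n) (P n).

Definition gamma (K : fieldType) (q : K) (j : nat) : K :=
  q ^+ 'C(j, 2) * \prod_(1 <= i < j.+1) (q ^+ i - 1).

(* For r <= n./2 one has 3 * r <= 2 * n, so the subtraction is exact. *)
Definition series_rhs (K : fieldType) (q : K) : fps K :=
  Fps (fun n : nat => q ^+ 'C(n, 2) *
    \sum_(r < n./2.+1)
      (q ^+ (r * (2 * n - 3 * r)) * gamma q r * gamma q (n - 2 * r))^-1).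

Definition product_identity (K : fieldType) (cvg : (nat -> K) -> K -> Prop)
    (q : K) : Prop :=
  let u := fpsX K in
  exists A B : fps K,
    [/\ fps_infinite_prod cvg (fun i => 1 + fpsC (q ^- i) * u) A,
        fps_infinite_prod cvg (fun i => 1 - fpsC (q ^- i) * u ^+ 2) B
      & A / B = series_rhs q].

(* Main.v *)
(* Write E_n = 1 / ((q - 1) ... (q^n - 1)).  The q-binomial theorem gives the
   coefficient of u^n in the partial product of the 1 + a u / q^i, i <= m, as
   a polynomial in q^-m whose value at 0 is a^n E_n; hence Euler's expansions
   of both infinite products, the second after the substitution u -> u^2.
   The inverse of sum_n (-1)^n E_n v^n is sum_n q^(n choose 2) E_n v^n, because
   their product is invariant under v -> v / q.  It remains to compare
   exponents of q. *)
Require Import Defs.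
From mathcomp Require Import all_boot all_order all_algebra.
From mathcomp Require Import reals complex.
From mathcomp Require Import boolp classical_sets topology normedtype sequences.
From mathcomp Require Import ring zify.
Import Order.TTheory GRing.Theory Num.Theory.
Import numFieldNormedType.Exports.
Local Open Scope ring_scope.
Local Open Scope complex_scope.

(** * Power series: multiplication by 1 + c u, and the substitutions u -> c u and u -> u^2 *)

Lemma fps_coef_mul1DX (R : comNzRingType) (c : R) (f : fps R) n :
  ((1 + fpsC c * fpsX R) * f) n.+1 = f n.+1 + c * f n.
Proof. by rewrite mulrDl mul1r fps_coefD -mulrA fps_coefCM fps_coefXM. Qed.

Lemma fps_coef_mul1DX0 (R : comNzRingType) (c : R) (f : fps R) :
  ((1 + fpsC c * fpsX R) * f) 0%N = f 0%N.
Proof.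
by rewrite mulrDl mul1r fps_coefD -mulrA fps_coefCM fps_coefXM mulr0 addr0.
Qed.

Definition fps_scale {R : comNzRingType} (c : R) (f : fps R) : fps R :=
  Fps (fun n => c ^+ n * f n).

Lemma fps_scaleM (R : comNzRingType) (c : R) (f g : fps R) :
  fps_scale c (f * g) = fps_scale c f * fps_scale c g.
Proof.
apply/fpsP => n; rewrite fps_coefM /= mulr_sumr; apply: eq_bigr => i _.
by rewrite mulrACA -exprD subnKC // -ltnS.
Qed.

Lemma sum_even (V : nmodType) (F : nat -> V) n :
  \sum_(i < n.+1) (if odd i then 0 else F i) = \sum_(r < n./2.+1) F r.*2.
Proof.
elim: n => [|n IHn]; first by rewrite !big_ord1.
rewrite big_ord_recr /= {}IHn uphalf_half; case: ifP => [/negbTE odd_n|even_n].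
  by rewrite odd_n addr0.
move/negbFE: even_n => odd_n.
rewrite odd_n add1n [RHS]big_ord_recr /=.
by rewrite -[in F n.+1](odd_double_half n) odd_n.
Qed.

Definition fps_comp_sqr {R : comNzRingType} (f : fps R) : fps R :=
  Fps (fun n => if odd n then 0 else f n./2).

Lemma fps_coef_comp_sqrM (R : comNzRingType) (f g : fps R) n :
  (fps_comp_sqr f * g) n = \sum_(r < n./2.+1) f r * g (n - r.*2)%N.
Proof.
under [RHS]eq_bigr => r _ do rewrite -[in f _](doubleK r).
rewrite -(sum_even _ (fun i => f i./2 * g (n - i)%N)) fps_coefM /=.
by apply: eq_bigr => i _; case: ifP; rewrite ?mul0r.
Qed.

Lemma fps_comp_sqrM (R : comNzRingType) (f g : fps R) :
  fps_comp_sqr (f * g) = fps_comp_sqr f * fps_comp_sqr g.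
Proof.
apply/fpsP => n; rewrite fps_coef_comp_sqrM /=.
have le2 (r : 'I_n./2.+1) : (r.*2 <= n)%N by have := ltn_ord r; lia.
case: ifP => odd_n.
  by rewrite big1 // => r _; rewrite oddB // odd_double addbF odd_n mulr0.
apply: eq_bigr => r _; rewrite oddB // odd_double addbF odd_n.
by congr (_ * g _); lia.
Qed.

Lemma fps_comp_sqr1 (R : comNzRingType) : fps_comp_sqr (1 : fps R) = 1.
Proof. by apply/fpsP => -[|[|n]] //=; case: ifP. Qed.

Lemma fps_comp_sqr1DX (R : comNzRingType) (c : R) :
  fps_comp_sqr (1 + fpsC c * fpsX R) = 1 + fpsC c * fpsX R ^+ 2.
Proof.
apply/fpsP => n; rewrite fps_coefD fps_coefCM -[fpsX R ^+ 2]mulr1.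
rewrite fps_coefXnM !fps_coef1.
transitivity (if odd n then 0 else (1 + fpsC c * fpsX R) n./2); first by [].
rewrite fps_coefD fps_coefCM fps_coef1.
case: n => [|[|[|n]]] /=; rewrite ?mulr0 ?addr0 //.
by rewrite negbK; case: ifP; case: n => //= n _; rewrite mulr0 addr0.
Qed.

(** * Euler's expansions and the identity for an abstract notion of convergence *)

Section EulerExpansion.

Variables (K : fieldType) (q : K).
Hypotheses (q_neq0 : q != 0) (q_nroot : forall i, (0 < i)%N -> q ^+ i != 1).

Let qn1_neq0 n : q ^+ n.+1 - 1 != 0.
Proof. by rewrite subr_eq0 q_nroot. Qed.

Definition euler_coef (n : nat) : K := (\prod_(1 <= i < n.+1) (q ^+ i - 1))^-1.

Lemma euler_coef0 : euler_coef 0 = 1.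
Proof. by rewrite /euler_coef big_nil invr1. Qed.

Lemma euler_coefS n : euler_coef n.+1 = euler_coef n / (q ^+ n.+1 - 1).
Proof. by rewrite /euler_coef big_nat_recr //= invfM. Qed.

Lemma gammaE n : gamma q n = q ^+ 'C(n, 2) / euler_coef n.
Proof. by rewrite /gamma /euler_coef invrK. Qed.

Lemma euler_coef_neq0 n : euler_coef n != 0.
Proof.
elim: n => [|n IHn]; first by rewrite euler_coef0 oner_neq0.
by rewrite euler_coefS mulf_eq0 negb_or IHn invr_eq0 qn1_neq0.
Qed.

(** The variable stands for q^-m. The roots q^-i with i < n reflect that a product of fewer than n
    factors has no term in u^n. *)
Definition euler_poly (a : K) (n : nat) : {poly K} :=
  (a ^+ n * euler_coef n) *: \prod_(i < n) (1 - q ^+ i *: 'X).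

Lemma horner_euler_poly a n y : (euler_poly a n).[y] =
  a ^+ n * euler_coef n * \prod_(i < n) (1 - q ^+ i * y).
Proof.
rewrite hornerZ horner_prod; congr (_ * _); apply: eq_bigr => i _.
by rewrite !hornerE.
Qed.

Lemma prod_fps1DX_coef a m n :
  (\prod_(1 <= i < m.+1) (1 + fpsC (a * q ^- i) * fpsX K) : fps K) n
    = (euler_poly a n).[q ^- m].
Proof.
elim: m n => [|m IHm] n.
  rewrite big_nil fps_coef1 horner_euler_poly expr0 invr1.
  case: n => [|n]; first by rewrite big_ord0 euler_coef0 !mulr1.
  (* At m = 0 the factor i = 0 is 1 - 1 = 0, as the empty product requires. *)
  by rewrite big_ord_recl expr0 mulr1 subrr mul0r mulr0.
rewrite big_nat_recr // [X in fps_coef X _]mulrC; case: n => [|n].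
  by rewrite fps_coef_mul1DX0 IHm !horner_euler_poly !big_ord0.
rewrite fps_coef_mul1DX !{}IHm !horner_euler_poly [in RHS]big_ord_recl.
rewrite [in LHS]big_ord_recr /= expr0 mul1r euler_coefS.
(* Since q^(i+1) q^-(m+1) = q^i q^-m, all three terms of the recurrence share the factor [T]; what
   remains is a rational identity in q. *)
have -> : \prod_(i < n) (1 - q ^+ lift ord0 i * q ^- m.+1)
        = \prod_(i < n) (1 - q ^+ i * q ^- m).
  apply: eq_bigr => i _; congr (1 - _).
  by rewrite /= !exprS invfM mulrACA divff ?mul1r.
set T := \prod_(i < n) _; have := qn1_neq0 n; rewrite !exprS => nz.
by field; rewrite nz q_neq0 expf_neq0.
Qed.

Definition euler_fps (a : K) : fps K := Fps (fun n => a ^+ n * euler_coef n).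

Definition euler_fps_inv : fps K := Fps (fun n => q ^+ 'C(n, 2) * euler_coef n).

(** Splitting the factor i = 1 off the product of the 1 + a u / q^i leaves the same product at u /
    q. *)
Lemma euler_fps_scale a :
  euler_fps a = (1 + fpsC (a * q^-1) * fpsX K) * fps_scale q^-1 (euler_fps a).
Proof.
apply/fpsP => -[|n]; first by rewrite fps_coef_mul1DX0 /= !mul1r.
rewrite fps_coef_mul1DX /= euler_coefS !exprVn.
have := qn1_neq0 n; rewrite !exprS => nz.
by field; rewrite nz q_neq0 expf_neq0.
Qed.

Lemma euler_fps_inv_scale : fps_scale q^-1 euler_fps_inv =
  (1 + fpsC (- 1 * q^-1) * fpsX K) * euler_fps_inv.
Proof.
apply/fpsP => -[|n]; first by rewrite fps_coef_mul1DX0 /= mul1r.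
rewrite fps_coef_mul1DX /= euler_coefS !exprVn binS bin1 exprD.
have := qn1_neq0 n; rewrite !exprS => nz.
by field; rewrite nz q_neq0 expf_neq0.
Qed.

Lemma euler_fpsK : euler_fps (- 1) * euler_fps_inv = 1.
Proof.
set F := _ * _.
have F_scale : fps_scale q^-1 F = F.
  (* The factor 1 - v/q produced by scaling the second series is exactly the one that the first
     series loses. *)
  by rewrite fps_scaleM euler_fps_inv_scale mulrCA mulrA -euler_fps_scale.
apply/fpsP => -[|n].
  by rewrite fps_coefM big_ord1 /= euler_coef0 !mulr1.
(* Invariance reads q^-(n+1) c = c for the coefficient c of index n+1, and q^(n+1) differs from 1,
   so c = 0. *)
move/fpsP/(_ n.+1)/eqP: F_scale; rewrite fps_coef1 /=.
rewrite -subr_eq0 -[X in _ - X]mul1r -mulrBl mulf_eq0 => /orP[|/eqP //].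
by rewrite subr_eq0 exprVn invr_eq1 (negPf (q_nroot _ _)).
Qed.

Lemma series_rhsE : fps_comp_sqr euler_fps_inv * euler_fps 1 = series_rhs q.
Proof.
apply/fpsP => n; rewrite fps_coef_comp_sqrM /= mulr_sumr; apply: eq_bigr => r _.
have le2 : (r.*2 <= n)%N by have := ltn_ord r; lia.
rewrite !gammaE -[in LHS]mul2n.
(* The two gammas remove one 'C(r, 2) and 'C(n - 2r, 2) from the exponent, leaving the single 'C(r,
   2) of [euler_fps_inv]. *)
have -> : 'C(n, 2) = (r * (2 * n - 3 * r) + 'C(r, 2).*2 + 'C(n - 2 * r, 2))%N.
  rewrite [in 'C(n - _, 2)]mul2n.
  have bin2D2 m : ('C(m, 2).*2 + m = m * m)%N.
    by elim: m => // m IHm; rewrite binS bin1; lia.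
  have := bin2D2 n; have := bin2D2 r; have := bin2D2 (n - r.*2)%N.
  move: (nat_of_ord r) le2 => k le2; move: (subnKC le2).
  move: (n - k.*2)%N => l <-.
  (* Writing n = 2k + l removes the truncated subtraction. *)
  have -> : (2 * (k.*2 + l) - 3 * k = k + l.*2)%N by lia.
  by rewrite -!mul2n; lia.
rewrite -['C(r, 2).*2]addnn !exprD expr1n mul1r.
by field; rewrite !expf_neq0 ?euler_coef_neq0.
Qed.

(** The coefficients of the partial products are polynomials in q^-m, so continuity of polynomials
    along q^-m -> 0 is all that is asked of either topology. *)
Lemma product_identity_of_cvg (cvg : (nat -> K) -> K -> Prop) :
  (forall p : {poly K}, cvg (fun m => p.[q ^- m]) p.[0]) ->
  product_identity cvg q.
Proof.
move=> cvg_poly.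
have cvg_euler a n : cvg (fun m => (euler_poly a n).[q ^- m]) (euler_fps a n).
  have -> : euler_fps a n = (euler_poly a n).[0].
    by rewrite horner_euler_poly big1 ?mulr1 // => i _; rewrite mulr0 subr0.
  exact: cvg_poly.
exists (euler_fps 1), (fps_comp_sqr (euler_fps (- 1))); split=> [n|n|].
- rewrite -[X in cvg X _](_ : (fun m => (euler_poly 1 n).[q ^- m]) = _) //.
  apply: funext => m; rewrite -prod_fps1DX_coef.
  by under eq_bigr => i _ do rewrite mul1r.
- under [X in cvg X _]eq_fun => m.
    have -> : \prod_(1 <= i < m.+1) (1 - fpsC (q ^- i) * fpsX K ^+ 2)
        = fps_comp_sqr
            (\prod_(1 <= i < m.+1) (1 + fpsC (- 1 * q ^- i) * fpsX K)).
      rewrite (big_morph fps_comp_sqr (@fps_comp_sqrM K) (@fps_comp_sqr1 K)).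
      apply: eq_bigr => i _; rewrite fps_comp_sqr1DX -mulNr; congr (1 + _ * _).
      by apply/fpsP => -[|k] /=; rewrite ?mulN1r ?oppr0.
    over.
  rewrite /=; case: ifP => _.
    (* Odd coefficients vanish; the zero polynomial gives convergence of the constant sequence 0. *)
    by have := cvg_poly 0; under eq_fun do rewrite horner0; rewrite horner0.
  by under eq_fun do rewrite prod_fps1DX_coef.
- have invB : fps_comp_sqr (euler_fps (- 1)) * fps_comp_sqr euler_fps_inv = 1.
    by rewrite -fps_comp_sqrM euler_fpsK fps_comp_sqr1.
  by rewrite (mulr1_eq invB) mulrC series_rhsE.
Qed.

End EulerExpansion.

(** * Continuity of polynomials in the formal and the complex setting *)

Lemma laurent_q_neq0 (F : fieldType) : laurent_q F != 0.
Proof.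
rewrite invr_eq0 tofrac_eq0; apply/eqP => /fpsP/(_ 1%N)/eqP.
by rewrite fps_coef0 oner_eq0.
Qed.

Lemma laurent_q_nroot (F : fieldType) i : (0 < i)%N -> laurent_q F ^+ i != 1.
Proof.
move=> i_gt0; rewrite -invr_eq1 -laurent_of_fpsXn -tofrac1 tofrac_eq.
apply/eqP => /fpsP/(_ 0%N)/eqP; rewrite -[_ ^+ i]mulr1 fps_coefXnM i_gt0.
by rewrite fps_coef1 eq_sym oner_eq0.
Qed.

Lemma laurent_cvg_horner (F : fieldType) (p : {poly laurent F}) :
  laurent_cvg (fun m => p.[laurent_q F ^- m]) p.[0].
Proof.
have qX_neq0 i : laurent_q F ^+ i != 0 by rewrite expf_neq0 ?laurent_q_neq0.
(* The exponent d bounds the powers of q in the coefficients of [p], uniformly in m. *)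
have repr_bound : exists d, forall m, exists w : fps F,
    p.[laurent_q F ^- m] - p.[0]
      = laurent_q F ^- m * (laurent_q F ^+ d * laurent_of_fps w).
  elim/poly_ind: p => [|p c [d IHp]].
    exists 0%N => m; exists 0.
    by rewrite !horner0 subrr tofrac0 !mulr0.
  have [k [f p0E]] := laurent_repr p.[0].
  exists (d + k)%N => m; have [w pE] := IHp m.
  (* This is (q^-m q^d w + q^k f) / q^(d+k), with [fpsX] in the role of q^-1. *)
  exists (fpsX F ^+ m * (fpsX F ^+ k * w) + fpsX F ^+ d * f).
  move/(canRL (subrK _)): pE => pE.
  rewrite !hornerMXaddC mulr0 add0r addrK {}pE {}p0E.
  rewrite tofracD !tofracM !laurent_of_fpsXn exprD mulrC; congr (_ * _).
  rewrite mulrDr [X in _ = X + _]mulrCA; congr (_ * _ + _).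
    by rewrite -mulrA mulVKf.
  by rewrite [_ ^+ d * _]mulrC -mulrA mulVKf.
(* From m >= k + d on, q^-m absorbs q^d and still leaves q^-k. *)
have [d pE] := repr_bound => k; exists (k + d)%N => m le_kdm.
have [w ->] := pE m; exists (fpsX F ^+ (m - (k + d)) * w).
rewrite tofracM laurent_of_fpsXn -[in LHS](subnK le_kdm) !exprD !invfM -!mulrA.
by rewrite mulKf // mulrCA.
Qed.

Lemma norm_cvg_horner (K : numFieldType) (p : {poly K}) (x : nat -> K) l :
  norm_cvg x l -> norm_cvg (fun m => p.[x m]) p.[l].
Proof.
move=> x_l; elim/poly_ind: p => [|p c IHp].
  by under eq_fun do rewrite horner0; rewrite horner0; exact: cvg_cst.
under eq_fun do rewrite hornerMXaddC; rewrite hornerMXaddC.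
by apply: cvgD; [exact: cvgM | exact: cvg_cst].
Qed.

Lemma norm_cvg_exprVn (R : realType) (q : R[i]) :
  1 < `|q| -> norm_cvg (fun m => q ^- m) 0.
Proof.
(* The norm on [R[i]] is itself complex-valued; passing to its real value r reduces the claim to the
   real geometric sequence r^-m. *)
rewrite /norm_cvg => q_gt1; have [r normqE] : exists r : R, `|q| = r%:C.
  by rewrite normc_def; eexists.
rewrite normqE -[1]/(1%:C) ltcR in q_gt1.
have r_gt0 : 0 < r by exact: lt_trans q_gt1.
have /cvgr0Pnorm_lt r_cvg :
    ((GRing.exp r^-1 : nat -> R) @ \oo --> (0 : R))%classic.
  by apply: cvg_expr; rewrite ger0_norm ?invf_lt1 // invr_ge0 ltW.
(* A positive element of [R[i]] has imaginary part 0, so the tolerance is real. *)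
apply/cvgr0Pnorm_lt => -[e e']; rewrite ltcE /= => /andP[/eqP-> e_gt0].
have := r_cvg e e_gt0; apply: filterS => m.
have -> : `|q ^- m| = (r^-1 ^+ m)%:C.
  by rewrite normfV normrX normqE -rmorphXn -fmorphV exprVn.
by rewrite -[e +i* 0]/(e%:C) ltcR ger0_norm // exprn_ge0 // invr_ge0 ltW.
Qed.

Theorem corollary3p5 :
  product_identity (@laurent_cvg rat) (laurent_q rat) /\
  (forall (R : realType) (q : R[i]), 1 < `|q| ->
     product_identity (@norm_cvg R[i]) q).
Proof.
split=> [|R q q_gt1].
  apply: product_identity_of_cvg; first exact: laurent_q_neq0.
    exact: laurent_q_nroot.
  exact: laurent_cvg_horner.
apply: product_identity_of_cvg => [|i i_gt0|p].
- by rewrite -normr_gt0 (lt_trans _ q_gt1).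
- apply/eqP => /(congr1 Num.norm)/eqP; rewrite normrX normr1.
  by rewrite gt_eqF // exprn_egt1 // -lt0n.
- by apply: norm_cvg_horner; exact: norm_cvg_exprVn.
Qed.
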